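(* Let $q$ be a prime power, let $X$ be a vector space over $\mathbb{F}_q$ of finite dimension $n\ge 1$, and let $b:X\times X\to\mathbb{F}_q$ be a symmetric non-degenerate bilinear form. Let $A_1,\dots,A_L \le X$ be subspaces, all of which have the same dimension $a$. Then $$\sum_{i=0}^{n-a} w_i(\mathcal{L}(A_1 \cup \cdots \cup A_L)) \begin{bmatrix} n-i \\ a \end{bmatrix}_q = \sum_{i=0}^{a} w_i(\mathcal{L}(A_1^\perp \cup \cdots \cup A_L^\perp)) \begin{bmatrix} n-i \\ a-i \end{bmatrix}_q.$$
   Context: For $V\le X$, $V^\perp=\{x\in X\mid b(x,y)=0\text{ for all }y\in V\}$. $\begin{bmatrix} r\\ s\end{bmatrix}_q$ is the $q$-binomial coefficient ($0$ if $s<0$ or $s>r$). For $A\subseteq X$, $\mathcal{L}(A)$ is the lattice, ordered by inclusion, of those subspaces of $X$ that have a basis made of elements of $A$, together with the zero space; it is a finite geometric lattice whose rank function is the $\mathbb{F}_q$-dimension. With $\mu_A$ its Möbius function, its $i$-th Whitney number (of the first kind) is $w_i(\mathcal{L}(A))=\sum_{U\in\mathcal{L}(A),\ \dim U=i}\mu_A(\{0\},U)$ (an empty sum is $0$). *)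

(* Defs.v *)
From HB Require Import structures.
From mathcomp Require Import all_boot all_order all_algebra all_field.
Set Implicit Arguments.
Unset Strict Implicit.
Unset Printing Implicit Defensive.
Import GRing.Theory.
Local Open Scope ring_scope.

Section FinVspace.
Import VectorInternalTheory.
Variables (F : finFieldType) (X : vectType F).
HB.instance Definition _ := [Countable of {vspace X} by <:].
HB.instance Definition _ := [Finite of {vspace X} by <:].
End FinVspace.

Section Mobius.
Variables (T : finType) (r : rel T) (S : {set T}).

(* [k] is a recursion bound: any [k >= #|S|] gives the same value on [S],     *)
(* since a strict chain in [S] has at most #|S| elements; see [mobiusE].      *)
Fixpoint mobius_rec (k : nat) (x y : T) : int :=
  if k is k'.+1 then
    if x == y then 1
    else if r x y then
      - \sum_(z in S | [&& r x z, r z y & z != y]) mobius_rec k' x z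
    else 0
  else 0.

Definition mobius (x y : T) : int := mobius_rec #|S| x y.

Lemma mobius_rec_stable k x y :
  antisymmetric r -> transitive r -> y \in S ->
  (#|[set z in S | r z y && (z != y)]| < k)%N ->
  mobius_rec k x y = mobius_rec #|[set z in S | r z y && (z != y)]|.+1 x y.
Proof.
move=> ras rtr; elim/ltn_ind: k x y => -[|k] IHk x y Sy //.
rewrite ltnS => le_k /=.
case: (x == y) => //; case: (r x y) => //; congr (- _).
apply: eq_bigr => z /andP[Sz /and3P[_ rzy nzy]].
have lt_zy : (#|[set t in S | r t z && (t != z)]|
              < #|[set t in S | r t y && (t != y)]|)%N.
  apply: proper_card; apply/properP; split; last first.
    by exists z; rewrite !inE ?Sz ?rzy ?nzy // eqxx !andbF.
  apply/subsetP => t; rewrite !inE => /and3P[-> rtz ntz] /=.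
  rewrite (rtr _ _ _ rtz rzy) /=; apply: contraNneq ntz => tE.
  by apply/eqP; apply: ras; rewrite rtz tE rzy.
have ltk : (#|[set t in S | r t z && (t != z)]| < k)%N by apply: leq_trans le_k.
by rewrite (IHk k _ x z) // (IHk _ _ x z Sz lt_zy).
Qed.

Lemma mobiusE x y :
    antisymmetric r -> transitive r -> x \in S -> y \in S ->
  mobius x y =
    if x == y then 1
    else if r x y then
      - \sum_(z in S | [&& r x z, r z y & z != y]) mobius x z
    else 0.
Proof.
move=> ras rtr Sx Sy.
have lt_S z : z \in S -> (#|[set t in S | r t z && (t != z)]| < #|S|)%N.
  move=> Sz; apply: proper_card; apply/properP; split.
    by apply/subsetP => t; rewrite inE => /andP[].
  by exists z; rewrite // !inE eqxx !andbF.
rewrite /mobius mobius_rec_stable ?lt_S //.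
rewrite -(@mobius_rec_stable #|S|.+1) ?ltnS ?(ltnW (lt_S _ Sy)) //=.
Qed.

End Mobius.

Section Geometry.
Variables (F : finFieldType) (X : vectType F).

(* [finvect_type X] is [X] with its finite type structure. *)
Definition basis_lattice (A : {pred X}) : {set {vspace X}} :=
  [set U : {vspace X} | (U == 0%VS) ||
    [exists s : (\dim U).-tuple (finvect_type X), basis_of U s && all A s]].

Lemma basis_latticeP (A : {pred X}) (U : {vspace X}) :
  reflect (U = 0%VS \/ exists2 s : seq X, basis_of U s & {subset s <= A})
          (U \in basis_lattice A).
Proof.
rewrite inE; apply: (iffP orP) => -[].
- by move/eqP; left.
- by case/existsP=> s /andP[bs /allP sA]; right; exists s.
- by move=> ->; left.
case=> s bs sA; right; apply/existsP.
have sz : size s == \dim U by rewrite (@size_basis _ _ _ _ (in_tuple s) bs).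
by exists (Tuple sz : (\dim U).-tuple (finvect_type X)); rewrite bs; apply/allP.
Qed.

Definition whitney (A : {pred X}) (i : nat) : int :=
  \sum_(U in basis_lattice A | \dim U == i)
    mobius (@subsetv F X) (basis_lattice A) 0%VS U.

Definition vunion (L : nat) (A : 'I_L -> {vspace X}) : {pred X} :=
  [pred x | [exists j, x \in A j]].

End Geometry.

Definition qbinom (q r s : nat) : rat :=
  if (s <= r)%N then
    \prod_(i < s) ((q%:R ^+ r - q%:R ^+ i) / (q%:R ^+ s - q%:R ^+ i))
  else 0.

(* Main.v *)
Require Import Defs.
From mathcomp Require Import all_boot all_order all_algebra all_field.
From mathcomp Require Import zify.
Set Implicit Arguments.
Unset Strict Implicit.
Unset Printing Implicit Defensive.
Import GRing.Theory Num.Theory.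
Local Open Scope ring_scope.

(** Both sides count the same [a]-dimensional subspaces, the left-hand side
    through their orthogonals.

    This is the critical problem of Crapo and Rota.  If [W] is a subspace, the
    members of the lattice of [A] that lie in [W] have a largest element, the
    span of [W :&: A]; hence the Möbius values [mu 0 U] over the lattice
    members [U] inside [W] sum to 1 if [W] meets [A] at most in 0, and to 0
    otherwise ([sum_mobius_sub]).  Summing over the [W] of a family in which
    the number of [W] above [U] depends only on [\dim U] turns the number of
    [W] that avoid [A] into a linear form in the Whitney numbers
    ([whitney_count]).

    For the family of all [a]-dimensional [W], the number of members above an
    [i]-dimensional [U] is the q-binomial coefficient [n - i] over [a - i]
    ([card_subspaces_between]), which gives the right-hand side.  For the
    family of all [W] whose orthogonal has dimension [a], taking orthogonals
    turns the [W] above [U] into the [a]-dimensional subspaces of [U^perp], of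
    which there are [n - i] over [a]; this gives the left-hand side.

    Finally, when [\dim U = \dim V] the spaces [U :&: V^perp] and [U^perp :&: V]
    have the same dimension ([capv_orthov_eq0]), so the involution
    [W |-> W^perp] exchanges the subspaces avoiding the union of the [A j] in
    the second family with those avoiding the union of the orthogonals
    [(A j)^perp] in the first. *)

(** * Möbius sums and Whitney numbers of the lattice of a set of vectors *)

Lemma sum_mobius (T : finType) (r : rel T) (S : {set T}) (x y : T) :
    reflexive r -> antisymmetric r -> transitive r ->
    x \in S -> y \in S -> r x y ->
  \sum_(z in S | r x z && r z y) mobius r S x z = (x == y)%:R.
Proof.
move=> rxx ras rtr Sx Sy rxy.
rewrite (bigD1 y) /=; last by rewrite Sy rxy rxx.
rewrite mobiusE // rxy; case: eqVneq => [<-|_].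
  rewrite big1 ?addr0 // => z /andP[/and3P[_ rxz rzx] /eqP[]].
  by apply: ras; rewrite rxz rzx.
apply/eqP; rewrite addrC subr_eq0; apply/eqP.
by apply: eq_bigl => z; rewrite -!andbA.
Qed.

(** Extracting a basis from a generating sequence is what puts the span of a
    set of elements of [A] in the lattice of [A]. *)
Lemma free_sub_span (K : fieldType) (vT : vectType K) (s : seq vT) :
  exists t : seq vT, [/\ free t, {subset t <= s} & <<t>>%VS = <<s>>%VS].
Proof.
elim: s => [|x s [t [ft ts spt]]]; first by exists [::]; rewrite nil_free.
have [xt|xNt] := boolP (x \in <<t>>%VS); last first.
  exists (x :: t); rewrite free_cons xNt ft !span_cons spt; split=> // y.
  by rewrite !inE => /orP[->|/ts->]; rewrite ?orbT.
exists t; split=> // [y /ts|]; first by rewrite inE orbC => ->.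
by rewrite span_cons -spt; apply/esym/addv_idPr; rewrite -memvE.
Qed.

Section Lattice.
Variables (F : finFieldType) (X : vectType F).
Implicit Types (A : {pred X}) (U V W : {vspace X}).

Definition avoids A W :=
  [forall x : finvect_type X, (x \in W) && (x \in A) ==> (x == 0)].

Definition trace_seq A W : seq X :=
  [seq x <- enum (finvect_type X) | (x \in W) && (x \in A)].

Definition trace_span A W : {vspace X} := <<trace_seq A W>>%VS.

Lemma mem_trace_seq A W x : (x \in trace_seq A W) = (x \in W) && (x \in A).
Proof.
have := mem_filter (fun y : finvect_type X => (y \in W) && (y \in A)) x
          (enum (finvect_type X)).
by rewrite mem_enum andbT.
Qed.

Lemma trace_span_lattice A W : trace_span A W \in basis_lattice A.
Proof.
apply/basis_latticeP; right.
have [t [ft ts spt]] := free_sub_span (trace_seq A W).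
exists t; first by rewrite basisEfree ft spt subvv -(eqP ft) spt leqnn.
by move=> x /ts; rewrite mem_trace_seq => /andP[].
Qed.

(** The trace of [A] on [W] spans the largest lattice member inside [W]. *)
Lemma subv_trace_span A U W :
  U \in basis_lattice A -> (U <= W)%VS = (U <= trace_span A W)%VS.
Proof.
move=> /basis_latticeP UA; apply/idP/idP => [UW|/subv_trans]; last first.
  by apply; apply/span_subvP => x; rewrite mem_trace_seq => /andP[].
case: UA => [->|[s bs sA]]; first exact: sub0v.
rewrite -(span_basis bs); apply/span_subvP => x xs; apply: memv_span.
rewrite mem_trace_seq; apply/andP; split; last exact: sA.
exact: (subvP UW _ (basis_mem bs xs)).
Qed.

Lemma trace_span_eq0 A W : (trace_span A W == 0%VS) = avoids A W.
Proof.
rewrite -subv0; apply/span_subvP/forallP => [h x|h x].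
  by apply/implyP => xWA; rewrite -memv0 h // mem_trace_seq.
by rewrite mem_trace_seq memv0; apply: (implyP (h x)).
Qed.

(** The defining recursion of the Möbius function, read at the largest lattice
    member inside [W], which is 0 exactly when [W] avoids [A]. *)
Lemma sum_mobius_sub A W :
  \sum_(U in basis_lattice A | (U <= W)%VS)
     mobius (@subsetv F X) (basis_lattice A) 0%VS U = (avoids A W)%:R.
Proof.
rewrite -trace_span_eq0 eq_sym.
rewrite -(@sum_mobius _ (@subsetv F X) (basis_lattice A)).
- apply: eq_bigl => U; case UA: (U \in _) => //=.
  by rewrite sub0v /= (subv_trace_span _ UA).
- exact: subvv.
- by move=> U V /andP[UV VU]; apply/eqP; rewrite eqEsubv UV.
- exact: subv_trans.
- by apply/basis_latticeP; left.
- exact: trace_span_lattice.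
- exact: sub0v.
Qed.

(** Double counting of the pairs [U <= W], with [U] in the lattice of [A]
    weighted by its Möbius value and [W] in [P].  The bound [N] drops
    dimensions in which no [U] is contained in a member of [P]. *)
Lemma whitney_count A (P : {set {vspace X}}) (N : nat) (c : nat -> rat) :
    (forall U, #|[set W in P | (U <= W)%VS]|%:R =
                 if (\dim U < N)%N then c (\dim U) else 0) ->
  #|[set W in P | avoids A W]|%:R =
    \sum_(0 <= i < N) (whitney A i)%:~R * c i.
Proof.
move=> hc; pose S := basis_lattice A.
pose mu U : rat := (mobius (@subsetv F X) S 0%VS U)%:~R.
transitivity (\sum_(U in S) mu U * (if (\dim U < N)%N then c (\dim U) else 0)).
  transitivity (\sum_(W in P) \sum_(U in S | (U <= W)%VS) mu U).
    rewrite -sum1_card natr_sum big_mkcond [RHS]big_mkcond /=.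
    apply: eq_bigr => W _; rewrite inE; case: (W \in P) => //=.
    by rewrite -rmorph_sum sum_mobius_sub; case: avoids.
  rewrite (exchange_big_dep (mem S)) /=; last by move=> ? ? _ /andP[].
  apply: eq_bigr => U SU; rewrite -hc mulr_natr -sumr_const.
  by apply: eq_bigl => W; rewrite inE SU.
rewrite big_mkord.
transitivity (\sum_(i < N) \sum_(U in S | \dim U == i) mu U * c i); last first.
  by apply: eq_bigr => i _; rewrite /whitney rmorph_sum mulr_suml.
rewrite (exchange_big_dep (mem S)) /=; last by move=> ? ? _ /andP[].
apply: eq_bigr => U SU; case: ltnP => [lt_UN|le_NU].
  rewrite (big_pred1 (Ordinal lt_UN)) // => i.
  by rewrite SU /= -[RHS](inj_eq val_inj) eq_sym.
rewrite mulr0 big1 // => i /andP[_ /eqP dU]; move: (ltn_ord i).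
by rewrite -dU ltnNge le_NU.
Qed.

Lemma card_memv V :
  #|[set x : finvect_type X | x \in V]| = (#|F| ^ \dim V)%N.
Proof.
rewrite cardsE.
(* The vector space structures of X and of its finite copy are convertible
   only once X is in constructor form. *)
case: X V => T cT V.
exact: (@card_vspace F (finvect_type (Vector.Pack cT)) cT V).
Qed.

Lemma card_diffv U W : (U <= W)%VS ->
  #|[set x : finvect_type X | (x \in W) && (x \notin U)]|%:R
    = #|F|%:R ^+ \dim W - #|F|%:R ^+ \dim U :> rat.
Proof.
move=> UW.
rewrite -!natrX -!card_memv.
rewrite -(cardsID [set x : finvect_type X | x \in U]
                  [set x : finvect_type X | x \in W]) natrD.
have -> : [set x : finvect_type X | x \in W] :&: [set x : finvect_type X | x \in U]
          = [set x : finvect_type X | x \in U].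
  by apply/setP=> x; rewrite !inE andb_idl // => /(subvP UW _).
rewrite addrC addKr; congr (_%:R); apply: eq_card => x.
by rewrite !inE andbC.
Qed.
End Lattice.

(** * Counting the subspaces of an interval *)

(** Both sides are 0 when [d = 0]: the factor [q ^ d - 1] makes the truncation
    of [d.-1] harmless. *)
Lemma qbinom_rec (q d m : nat) : (1 < q)%N ->
  qbinom q d m.+1 * (q%:R ^+ m.+1 - 1) = qbinom q d.-1 m * (q%:R ^+ d - 1).
Proof.
move=> q_gt1; case: d => [|d] /=.
  by rewrite /qbinom ltn0 mul0r expr0 subrr mulr0.
rewrite /qbinom ltnS; case: leqP => _; last by rewrite !mul0r.
have q0 : q%:R != 0 :> rat by rewrite pnatr_eq0; lia.
have qm : q%:R ^+ m.+1 - 1 != 0 :> rat.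
  by rewrite subr_eq0 -natrX (eqr_nat _ _ 1) -(expn0 q) eqn_exp2l.
rewrite big_ord_recl /= expr0 mulrAC divfK // mulrC; congr (_ * _).
apply: eq_bigr => i _; rewrite /= !exprS -!mulrBr.
by rewrite -mulf_div divff // mul1r.
Qed.

Lemma qbinom0 (q d : nat) : qbinom q d 0 = 1.
Proof. by rewrite /qbinom big_ord0. Qed.

(** Induction on [m], counting in two ways the pairs [(x, W)] where [W] has
    dimension [\dim U + m.+1] and [x] lies in [W] but not in [U]: [W] is one of
    the spaces sought and [x] one of [q ^ \dim W - q ^ \dim U] vectors, or [x]
    is one of [q ^ \dim V - q ^ \dim U] vectors and [W] lies between [U + <[x]>]
    and [V]. *)
Lemma card_subspaces_between (F : finFieldType) (X : vectType F)
    (U V : {vspace X}) (m : nat) : (U <= V)%VS ->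
  #|[set W : {vspace X} | [&& U <= W, W <= V & \dim W == (\dim U + m)%N]%VS]|%:R
    = qbinom #|F| (\dim V - \dim U) m.
Proof.
pose q : rat := #|F|%:R; have q_gt1 := finNzRing_gt1 F.
elim: m U => [|m IHm] U UV.
  rewrite qbinom0 (_ : [set _ | _] = [set U]) ?cards1 //.
  apply/setP=> W; rewrite !inE addn0; apply/and3P/eqP => [[UW _ dW]|->].
    by apply/esym/eqP; rewrite eqEdim UW (eqP dW) leqnn.
  by rewrite subvv eqxx.
set N : rat := _%:R; set d := (_ - _)%N.
have dV : (\dim V = \dim U + d)%N by rewrite subnKC // dimvS.
have q0 : q != 0 by rewrite pnatr_eq0 -lt0n ltnW.
have nz : q ^+ m.+1 - 1 != 0.
  by rewrite subr_eq0 -natrX (eqr_nat _ _ 1) -(expn0 #|F|) eqn_exp2l.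
apply: (mulIf nz); rewrite qbinom_rec //.
apply: (mulIf (expf_neq0 (\dim U) q0)); rewrite -!mulrA !mulrBl !mul1r -!exprD.
rewrite ![(_ + \dim U)%N]addnC -dV.
transitivity (\sum_(W : {vspace X} |
      [&& U <= W, W <= V & \dim W == (\dim U + m.+1)%N]%VS)
    \sum_(x : finvect_type X | (x \in W) && (x \notin U)) 1 : rat).
  rewrite mulr_natl -sumr_const; apply: eq_big => [W|W]; rewrite inE //.
  case/and3P=> UW WV /eqP dW; rewrite -dW -card_diffv // sumr_const.
  by congr (_ *+ _); apply: eq_card => x; rewrite inE.
rewrite (exchange_big_dep
  (fun x : finvect_type X => (x \in V) && (x \notin U))) /=; last first.
  by move=> W x /and3P[_ WV _] /andP[xW ->]; rewrite (subvP WV).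
rewrite -card_diffv // -sumr_const mulr_sumr.
apply: eq_big => [x|x /andP[xV xU]]; first by rewrite inE.
have dUx : \dim (U + <[x : X]>)%VS = (\dim U).+1.
  rewrite dimv_disjoint_sum ?dim_vline.
    by rewrite (_ : (x != 0) = true) ?addn1 //; apply: contraNneq xU => ->; exact: mem0v.
  apply/eqP; rewrite -subv0; apply/subvP => y; rewrite memv_cap memv0.
  case/andP=> yU /vlineP[k yE]; move: yU; rewrite yE.
  by rewrite rpredZeq (negPf xU) orbF => /eqP ->; rewrite scale0r.
have -> : d.-1 = (\dim V - \dim (U + <[x : X]>)%VS)%N by rewrite dUx; lia.
rewrite mulr1 -IHm; last by rewrite subv_add UV -memvE.
rewrite sumr_const; congr (_%:R); apply: eq_card => W; rewrite !inE xU.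
rewrite dUx addSnnS subv_add -memvE.
rewrite unfold_in /= andbT.
by case: (_ <= W)%VS; case: (x \in W); case: (_ <= V)%VS; case: (_ == _).
Qed.

(** * Orthogonals for a non-degenerate form *)

Section Orthogonal.
Variables (F : fieldType) (X : vectType F) (b : {symmetric X}).
Implicit Types U V W : {vspace X}.
Local Notation orth := (orthov b).

Lemma orthovD_cap U V : orth (U + V) = (orth U :&: orth V)%VS.
Proof.
apply/eqP; rewrite eqEsubv subv_cap -orthovD subvv /= orthovD.
by rewrite capvSl capvSr.
Qed.

Lemma orthov_id_sub U : (U <= orth (orth U))%VS.
Proof. by rewrite orthov_sym. Qed.

(** Each new vector of [s] cuts the dimension by at most 1. *)
Lemma dim_cap_orthov_span U (s : seq X) :
  (\dim U <= \dim (U :&: orth <<s>>) + size s)%N.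
Proof.
elim: s => [|x s IHs]; first by rewrite span_nil orthov0 capvf addn0.
rewrite span_cons addvC orthovD_cap capvA /=.
have := leq_dim_orthov1 b x (U :&: orth <<s>>); lia.
Qed.

Lemma dim_cap_orthov U W : (\dim U <= \dim (U :&: orth W) + \dim W)%N.
Proof.
by have := dim_cap_orthov_span U (vbasis W);
   rewrite (span_basis (vbasisP W)) size_tuple.
Qed.

Hypothesis hb : nondegenerate b.

(** [dim_cap_orthov] with the whole space in place of [U] is one inequality.
    For the other, apply it to [U] and a complement [C] of [U^perp]: a vector of
    [U] orthogonal to [C] is orthogonal to [U^perp + C], the whole space, hence
    is 0; so [\dim U <= \dim C]. *)
Lemma dim_orthov U : (\dim U + \dim (orth U) = \dim {:X})%N.
Proof.
have le1 := dim_cap_orthov fullv U; rewrite capfv in le1.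
pose C := (orth U)^C%VS.
have dC : (\dim (orth U) + \dim C = \dim {:X})%N.
  by rewrite -dimv_disjoint_sum ?addv_complf ?capv_compl.
have := dim_cap_orthov U C.
suff -> : (U :&: orth C = 0)%VS by rewrite dimv0; lia.
apply/eqP; rewrite -subv0 -(eqP hb) -(addv_complf (orth U)) orthovD_cap.
by rewrite subv_cap capvSr (subv_trans (capvSl _ _) (orthov_id_sub _)).
Qed.

Lemma orthovK : involutive orth.
Proof.
move=> U; apply/esym/eqP; rewrite eqEdim orthov_id_sub /=.
by have := dim_orthov U; have := dim_orthov (orth U); lia.
Qed.

(** [U^perp :&: V] is the orthogonal of [U + V^perp], whose dimension falls
    short of the full one by exactly [\dim (U :&: V^perp)] when [U] and [V] have
    equal dimension. *)
Lemma capv_orthov_eq0 U V : \dim U = \dim V ->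
  (U :&: orth V == 0)%VS = (orth U :&: V == 0)%VS.
Proof.
move=> dUV; rewrite -!dimv_eq0; congr (_ == 0%N).
have := dimv_sum_cap U (orth V); have := dim_orthov V.
by have := dim_orthov (U + orth V); rewrite orthovD_cap orthovK; lia.
Qed.
End Orthogonal.

(** * The duality of Whitney numbers *)

Lemma avoids_vunion (F : finFieldType) (X : vectType F) (L : nat)
    (A : 'I_L -> {vspace X}) (W : {vspace X}) :
  avoids (vunion A) W = [forall j, (W :&: A j == 0)%VS].
Proof.
apply/forallP/forallP => [h j|h x].
  rewrite -subv0; apply/subvP => x; rewrite memv_cap memv0 => /andP[xW xA].
  by apply: (implyP (h x)); rewrite xW inE; apply/existsP; exists j.
apply/implyP; rewrite inE => /andP[xW /existsP[j xA]].
have : (x : X) \in (W :&: A j)%VS by rewrite memv_cap xW.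
by rewrite (eqP (h j)) memv0.
Qed.

Theorem theorem4p5 (F : finFieldType) (q : nat) (hq : #|F| = q)
    (X : vectType F) (n : nat) (hn : \dim {:X} = n) (n_ge1 : (1 <= n)%N)
    (b : {symmetric X}) (hb : nondegenerate b)
    (L a : nat) (A : 'I_L -> {vspace X}) (hA : forall j, \dim (A j) = a) :
  \sum_(0 <= i < (n - a).+1)
     (whitney (vunion A) i)%:~R * qbinom q (n - i) a
  = \sum_(0 <= i < a.+1)
     (whitney (vunion (fun j => orthov b (A j))) i)%:~R
       * qbinom q (n - i) (a - i).
Proof.
have dimO U := dim_orthov hb U; rewrite hn in dimO.
have OK := orthovK hb.
(* The left family is not described by \dim W = n - a: that truncated
   difference would be wrong when L = 0 and n < a. *)
rewrite -(@whitney_count _ _ _ [set W | \dim (orthov b W) == a]).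
rewrite -(@whitney_count _ _ _ [set W | \dim W == a]
  _ (fun i => qbinom q (n - i) (a - i))).
- congr (_%:R); rewrite -(card_imset _ (inv_inj OK)).
  apply: eq_card => V; apply/imsetP/idP => [[W + ->]|].
    rewrite !inE !avoids_vunion => /andP[dW /forallP h]; rewrite dW /=.
    by apply/forallP => j; rewrite capv_orthov_eq0 ?OK ?(eqP dW) ?hA.
  rewrite !inE !avoids_vunion => /andP[dW /forallP h].
  exists (orthov b V); rewrite ?OK // !inE OK dW avoids_vunion /=.
  by apply/forallP => j; rewrite -capv_orthov_eq0 // (eqP dW) hA.
- move=> U; rewrite ltnS; case: leqP => [le_Ua|lt_aU]; last first.
    rewrite (_ : [set W in _ | _] = set0) ?cards0 //.
    apply/setP=> W; rewrite !inE; apply: contraTF lt_aU => /andP[/eqP<- UW].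
    by rewrite -leqNgt dimvS.
  rewrite -hq -hn -(card_subspaces_between _ (subvf U)).
  congr (_%:R); apply: eq_card => W; rewrite !inE subvf subnKC //=.
  by rewrite andbC.
(* The spaces above U with a-dimensional orthogonal, counted through their
   orthogonals, which are the a-dimensional subspaces of the orthogonal of U. *)
- move=> U; transitivity (qbinom q (n - \dim U) a).
    have -> : (n - \dim U = \dim (orthov b U) - \dim (0%VS : {vspace X}))%N.
      by have := dimO U; rewrite dimv0; lia.
    rewrite -hq -(card_subspaces_between _ (sub0v _)).
    congr (_%:R); rewrite -(card_imset _ (inv_inj OK)).
    apply: eq_card => V; apply/idP/imsetP => [|[W + ->]].
      rewrite !inE => /andP[dV UV]; exists (orthov b V); rewrite ?OK //.
      by rewrite !inE dimv0 sub0v dV orthov_sym OK UV.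
    by rewrite !inE dimv0 => /and3P[_ WU dW]; rewrite OK dW orthov_sym.
  case: ltnP => // lt; rewrite /qbinom ifF //; apply/negbTE; rewrite -ltnNge.
  by have := dimO U; lia.
Qed.
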